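(* Let $q(P)=\|P\|$ be a norm on $\mathbb{P}(\mathbb{C}^N)$. Then the following two conditions are equivalent: (1) $q\in\mathcal{VM}$; (2) there exist a $\mathcal{KL}$ majorant $\varphi(n,k)$ of $q$ and positive constants $A,B,\alpha$ such that $\varphi(n,1)\le A n^\alpha$ and $\varphi(n,n)\le B^n\, n!$ for all integers $n\ge1$.
   Context: $\mathbb{P}(\mathbb{C}^N)$ is the vector space of polynomials in $N$ variables with complex coefficients. For a norm $q(P)=\|P\|$ on $\mathbb{P}(\mathbb{C}^N)$ and integers $1\le k\le n$ put $$M_q(n,k)=\sup\{\|D^\alpha P\|:\ |\alpha|=k,\ k\le\deg P\le n,\ \|P\|=1\}.$$ A triangular array of positive numbers $\varphi(n,k)$, $1\le k\le n$, $n\in\{1,2,\dots\}$, belongs to the Kolmogorov-Landau class $\mathcal{KL}$ if, with $\psi(n,k):=\varphi(n,k)^{1/k}$, there is a constant $C>0$ such that for all $n>1$ and all $1\le k\le n$ $$\log\psi(n,k)\le \log C+\left(1-\frac{\log k}{\log n}\right)\log\psi(n,1)+\frac{\log k}{\log n}\log\psi(n,n).$$ A $\mathcal{KL}$ majorant of $q$ is an array $\varphi(n,k)\in\mathcal{KL}$ such that $M_q(n,k)\le\varphi(n,k)$ for all $1\le k\le n$. One writes $q\in\mathcal{VM}$ (V. Markov property) if there are constants $M>0$, $m\ge 1$ with $M_q(n,k)\le M^k n^{km}/(k!)^{m-1}$ for all $1\le k\le n$. *)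

(* Defs.v *)
From mathcomp Require Import all_boot all_order all_algebra.
From mathcomp Require Import boolp classical_sets reals ereal exp.
From mathcomp Require Import complex.
(* The notations of mpoly clash with those of MathComp-Analysis. *)
From mathcomp Require Import -(notations) mpoly.

Set Implicit Arguments.
Unset Strict Implicit.
Unset Printing Implicit Defensive.

Import Order.TTheory GRing.Theory Num.Theory.
Local Open Scope classical_set_scope.
Local Open Scope ring_scope.

Notation cpoly R N := (mpoly N R[i]).

Section Markov.
Variables (R : realType) (N : nat).

(* The ring of coefficients is R[i], whose own norm is R[i]-valued;
   [ComplexField.Normc.normc] is the R-valued modulus. *)
Record is_norm (q : cpoly R N -> R) : Prop := IsNorm {
  norm_definite : forall P : cpoly R N, q P = 0 -> P = 0;
  norm_homogeneous : forall (c : R[i]) (P : cpoly R N),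
    q (c *: P) = ComplexField.Normc.normc c * q P;
  norm_triangle : forall P Q : cpoly R N, q (P + Q) <= q P + q Q }.

(* The zero polynomial is given degree 0 here; it never has norm 1. *)
Definition total_degree (P : cpoly R N) : nat := (mpoly.msize P).-1.

(* The supremum is taken in the extended reals, so that no finiteness is
   presupposed. *)
Definition markov_factor (q : cpoly R N -> R) (n k : nat) : \bar R :=
  ereal_sup [set x : \bar R |
    exists (a : multinom N) (P : cpoly R N),
      [/\ mdeg a = k, (k <= total_degree P <= n)%N, q P = 1
        & x = (q (mderivm a P))%:E]].

Definition VM (q : cpoly R N -> R) : Prop :=
  exists M m : R, [/\ 0 < M, 1 <= m &
    forall n k : nat, (1 <= k <= n)%N ->
      (markov_factor q n k <=
        (M ^+ k * n%:R `^ (k%:R * m) / k`!%:R `^ (m - 1))%:E)%E].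

(* Only the values [phi n k] with 1 <= k <= n are meaningful. *)
Definition KL (phi : nat -> nat -> R) : Prop :=
  let psi n k := phi n k `^ k%:R^-1 in
  (forall n k : nat, (1 <= k <= n)%N -> 0 < phi n k) /\
  exists2 C : R, 0 < C &
    forall n k : nat, (1 < n)%N -> (1 <= k <= n)%N ->
      ln (psi n k) <= ln C + (1 - ln k%:R / ln n%:R) * ln (psi n 1%N)
                      + ln k%:R / ln n%:R * ln (psi n n).

Definition KL_majorant (q : cpoly R N -> R) (phi : nat -> nat -> R) : Prop :=
  KL phi /\
  forall n k : nat, (1 <= k <= n)%N -> (markov_factor q n k <= (phi n k)%:E)%E.

End Markov.

(* Main.v *)
Require Import Defs.
From mathcomp Require Import all_boot all_order all_algebra.
From mathcomp Require Import boolp classical_sets reals ereal exp.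
From mathcomp Require Import complex.
From mathcomp Require Import -(notations) mpoly.
From mathcomp Require Import sequences ring lra.

(** The polynomials enter only through the numbers [markov_factor q n k], which
    occur in both conditions as quantities to be bounded from above.  So the
    theorem is about majorizing arrays: the Markov arrays
    [M ^ k n ^ (k m) / k! ^ (m - 1)] belong to the class KL, their two ends
    [k = 1] and [k = n] grow at most like [n ^ m] and [n!], and they dominate
    every array of the class with ends of such growth.

    Take logarithms of k-th roots.  Stirling's formula in its crudest form,
    [log k - 1 <= (log k!) / k <= log k], turns the Markov array into
    [log psi(n, k) = log M + m log n - (m - 1) log k], up to a bounded error.
    For fixed [n] this is an affine function of [log k], so it agrees with the
    linear interpolation, in [log k / log n], between its values at [k = 1]
    and [k = n]; this is the KL condition ([markov_array_KL]).  The values at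
    the two ends are [M n ^ m] exactly and [n!] up to a geometric factor
    ([markov_array_diag]).

    Conversely, the KL inequality interpolates the two bounds at the ends, and
    interpolating between [alpha log n] at [k = 1] and [log n] at [k = n]
    gives [alpha log n - (alpha - 1) log k], which is the Markov array of
    exponent [alpha] again ([KL_le_markov_array]).  An exponent below 1 is
    first raised to 1. *)

Set Implicit Arguments.
Unset Strict Implicit.
Unset Printing Implicit Defensive.

Import Order.TTheory GRing.Theory Num.Theory.

Local Open Scope ring_scope.

Section MarkovArrays.
Variable R : realType.
Implicit Types (A B C M m alpha : R) (n k : nat).

Lemma ln_nat_ge0 n : 0 <= ln n%:R :> R.
Proof.
case: n => [|n]; first by rewrite ln0.
by rewrite ln_ge0 // ler1n.
Qed.

Lemma ler_ln_nat k n : (0 < k <= n)%N -> ln k%:R <= ln n%:R :> R.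
Proof.
move=> /andP[k0 kn].
by rewrite ler_ln ?posrE ?ltr0n ?ler_nat // (leq_trans k0).
Qed.

Lemma ln_fact_rec n : ln (n.+1)`!%:R = ln n.+1%:R + ln n`!%:R :> R.
Proof. by rewrite factS natrM lnM ?posrE ?ltr0n ?fact_gt0. Qed.

Lemma natr_mulSl n (x : R) : n.+1%:R * x = x + n%:R * x.
Proof. by rewrite -natr1 mulrDl mul1r addrC. Qed.

Lemma ln_fact_le n : ln n`!%:R <= n%:R * ln n%:R :> R.
Proof.
elim: n => [|n IHn]; first by rewrite fact0 ln1 mul0r.
rewrite ln_fact_rec natr_mulSl lerD2l.
apply: (le_trans IHn); case: n {IHn} => [|n]; first by rewrite !mul0r.
by rewrite ler_wpM2l ?ler_ln_nat /=.
Qed.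

(** This is [n ^ n <= e ^ n n!]; the induction step amounts to
    [(1 + 1 / n) ^ n <= e]. *)
Lemma ln_fact_ge n : n%:R * (ln n%:R - 1) <= ln n`!%:R :> R.
Proof.
elim: n => [|n IHn]; first by rewrite fact0 ln1 mul0r.
case: n IHn => [_|n IHn]; first by rewrite (_ : 1`! = 1%N) // ln1; lra.
rewrite ln_fact_rec natr_mulSl.
set x : R := n.+1%:R in IHn *.
have x0 : 0 < x by rewrite ltr0n.
have ratio : n.+2%:R = x * (1 + x^-1) :> R.
  by rewrite mulrDr mulr1 mulfV ?gt_eqF // natr1.
have step : x * ln n.+2%:R <= x * ln x + 1.
  rewrite ratio lnM ?posrE // ?addr_gt0 ?invr_gt0 // mulrDr lerD2l.
  rewrite -[leRHS](mulfV (lt0r_neq0 x0)) ler_pM2l //.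
  by apply: le_ln1Dx; rewrite (lt_trans (ltrN10 _)) ?invr_gt0.
by lra.
Qed.

Definition markov_array M m n k : R :=
  M ^+ k * n%:R `^ (k%:R * m) / k`!%:R `^ (m - 1).

Lemma markov_array_gt0 M m n k :
  0 < M -> (0 < n)%N -> 0 < markov_array M m n k.
Proof.
move=> M0 n0.
by rewrite divr_gt0 ?mulr_gt0 ?exprn_gt0 ?powR_gt0 ?ltr0n ?fact_gt0.
Qed.

Lemma ln_markov_array M m n k : 0 < M -> (0 < n)%N ->
  ln (markov_array M m n k) =
    k%:R * (ln M + m * ln n%:R) - (m - 1) * ln k`!%:R.
Proof.
move=> M0 n0.
have Mk0 : 0 < M ^+ k by rewrite exprn_gt0.
have nk0 : 0 < n%:R `^ (k%:R * m) by rewrite powR_gt0 ?ltr0n.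
have fk0 : 0 < k`!%:R `^ (m - 1) by rewrite powR_gt0 ?ltr0n ?fact_gt0.
rewrite ln_div ?posrE ?mulr_gt0 // lnM ?posrE // lnXn // !ln_powR.
by rewrite -mulr_natl; ring.
Qed.

Lemma ln_root_markov_array M m n k : 0 < M -> (0 < n)%N -> (0 < k)%N ->
  ln (markov_array M m n k `^ k%:R^-1) =
    ln M + m * ln n%:R - (m - 1) * (ln k`!%:R / k%:R).
Proof.
move=> M0 n0 k0; rewrite ln_powR ln_markov_array //.
by field; rewrite pnatr_eq0 -lt0n.
Qed.

(** Only [m - 1] times the error in Stirling's formula has to be absorbed by
    the constant, so [exp (m - 1)] will do. *)
Lemma markov_array_KL M m : 0 < M -> 1 <= m -> KL (markov_array M m).
Proof.
move=> M0 m1; split=> [n k /andP[k0 kn]|].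
  by rewrite markov_array_gt0 // (leq_trans k0).
exists (expR (m - 1)) => [|n k n1 /andP[k0 kn]].
  exact: expR_gt0.
have n0 : (0 < n)%N := ltnW n1.
rewrite expRK !ln_root_markov_array // (_ : 1`! = 1%N) // ln1 mul0r.
set L := ln n%:R; set l := ln k%:R.
set fk := ln k`!%:R / _; set fn := ln n`!%:R / _; set t := l / L.
have L0 : 0 < L by rewrite ln_gt0 // ltr1n.
have t0 : 0 <= t by rewrite divr_ge0 ?ln_nat_ge0.
have fk_ge : l - 1 <= fk.
  by rewrite ler_pdivlMr ?ltr0n // mulrC ln_fact_ge.
have tfn_le : t * fn <= l.
  rewrite -[leRHS](divfK (lt0r_neq0 L0)) ler_wpM2l //.
  by rewrite ler_pdivrMr ?ltr0n // mulrC ln_fact_le.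
have : (m - 1) * (t * fn) <= (m - 1) * (fk + 1).
  by rewrite ler_wpM2l ?subr_ge0 //; lra.
by lra.
Qed.

Lemma markov_array_diag M m n : 0 < M -> 1 <= m -> (0 < n)%N ->
  markov_array M m n n <= (M * expR m) ^+ n * n`!%:R.
Proof.
move=> M0 m1 n0.
have B0 : 0 < M * expR m by rewrite mulr_gt0 ?expR_gt0.
have Bn0 : 0 < (M * expR m) ^+ n by rewrite exprn_gt0.
have fn0 : 0 < n`!%:R :> R by rewrite ltr0n fact_gt0.
rewrite -ler_ln ?posrE ?markov_array_gt0 ?mulr_gt0 //.
rewrite ln_markov_array // [in leRHS]lnM ?posrE // lnXn // lnM ?posrE //.
  rewrite expRK -[X in _ <= X + _]mulr_natl.
  have := ler_wpM2l (le_trans ler01 m1) (ln_fact_ge n).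
  by lra.
exact: expR_gt0.
Qed.

(** The exponent is [max 1 alpha], since a Markov array needs one that is at
    least 1.  The constant is built from the absolute values of [ln A] and
    [ln B], so that it bounds all their interpolants at once; that of [ln C]
    keeps it above [A], which settles [n = 1], where the KL inequality says
    nothing. *)
Lemma KL_le_markov_array (phi : nat -> nat -> R) A B alpha :
  KL phi -> 0 < A -> 0 < B ->
  (forall n, (1 <= n)%N ->
     phi n 1%N <= A * n%:R `^ alpha /\ phi n n <= B ^+ n * n`!%:R) ->
  exists2 M, 0 < M &
    forall n k, (1 <= k <= n)%N ->
      phi n k <= markov_array M (Num.max 1 alpha) n k.
Proof.
move=> [phi0 [C C0 phiKL]] A0 B0 ends.
set m := Num.max 1 alpha.
exists (expR (`|ln C| + `|ln A| + `|ln B|)) => [|n k kn].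
  exact: expR_gt0.
have [k1 kn'] := andP kn; have n0 : (0 < n)%N := leq_trans k1 kn'.
rewrite -ler_ln ?posrE ?phi0 ?markov_array_gt0 ?expR_gt0 //.
rewrite ln_markov_array ?expR_gt0 // expRK.
have m1 : 1 <= m by rewrite le_max lexx.
have malpha : alpha <= m by rewrite le_max lexx orbT.
have L0 : 0 <= ln n%:R :> R := ln_nat_ge0 n.
have [end1 endn] := ends n n0.
have lnphi1 : ln (phi n 1%N) <= ln A + m * ln n%:R.
  have An0 : 0 < n%:R `^ alpha :> R by rewrite powR_gt0 ?ltr0n.
  apply: (@le_trans _ _ (ln A + alpha * ln n%:R)).
    by rewrite -ln_powR -lnM ?posrE // ler_ln ?posrE ?mulr_gt0 ?phi0 ?n0.
  by rewrite lerD2l ler_wpM2r.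
have := ler_norm (ln C); have := ler_norm (ln A); have := ler_norm (ln B).
have := normr_ge0 (ln C); have := normr_ge0 (ln A).
have := normr_ge0 (ln B).
set c := `|ln C|; set a := `|ln A|; set b := `|ln B|.
move=> b0 a0 c0 bB aA cC.
case: (ltnP 1 n) => [n1|n_le1]; last first.
  have n_eq1 : n = 1%N by apply/eqP; rewrite eqn_leq n_le1 n0.
  have k_eq1 : k = 1%N by apply/eqP; rewrite eqn_leq k1 -n_eq1 kn'.
  move: lnphi1; rewrite n_eq1 k_eq1 (_ : 1`! = 1%N) // ln1; lra.
have lnphin : n%:R^-1 * ln (phi n n) <= ln B + ln n%:R.
  have fn0 : 0 < n`!%:R :> R by rewrite ltr0n fact_gt0.
  have Bn0 : 0 < B ^+ n by rewrite exprn_gt0.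
  rewrite ler_pdivrMl ?ltr0n // mulrDr.
  apply: (@le_trans _ _ (ln (B ^+ n) + ln n`!%:R)).
    by rewrite -lnM ?posrE // ler_ln ?posrE ?mulr_gt0 ?phi0 ?n0 /=.
  by rewrite lnXn // mulr_natl lerD2l ln_fact_le.
have := phiKL n k n1 kn; rewrite !ln_powR invr1 mul1r.
set L := ln n%:R in L0 lnphi1 lnphin *; set l := ln k%:R; set t := l / L.
have Lgt0 : 0 < L by rewrite ln_gt0 // ltr1n.
have t0 : 0 <= t by rewrite divr_ge0 ?ln_nat_ge0.
have t1 : 0 <= 1 - t by rewrite subr_ge0 ler_pdivrMr // mul1r ler_ln_nat.
have tL : t * L = l by rewrite divfK ?gt_eqF.
move=> phik.
have end1' : (1 - t) * ln (phi n 1%N) <= a + (1 - t) * (m * L).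
  apply: (le_trans (ler_wpM2l t1 lnphi1)); rewrite mulrDr lerD2r.
  have := ler_wpM2l t1 aA; have := mulr_ge0 t0 a0; lra.
have endn' : t * (n%:R^-1 * ln (phi n n)) <= b + l.
  apply: (le_trans (ler_wpM2l t0 lnphin)); rewrite mulrDr tL lerD2r.
  have := ler_wpM2l t0 bB; have := mulr_ge0 t1 b0; lra.
have interpolation : (1 - t) * (m * L) + l = m * L - (m - 1) * l.
  by rewrite -tL; ring.
have root : k%:R^-1 * ln (phi n k) <= c + a + b + (m * L - (m - 1) * l).
  by rewrite -interpolation; lra.
move: root; rewrite ler_pdivrMl ?ltr0n // => root.
(* Trading [k ln k] for the smaller [ln k!] needs [m - 1] to be nonnegative. *)
have := ler_wpM2l (_ : 0 <= m - 1) (ln_fact_le k).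
rewrite subr_ge0 -/l => /(_ m1); lra.
Qed.

End MarkovArrays.

Theorem theorem6p8 (R : realType) (N : nat) (hN : (0 < N)%N)
    (q : cpoly R N -> R) (hq : is_norm q) :
  VM q <->
  exists (phi : nat -> nat -> R) (A B alpha : R),
    [/\ KL_majorant q phi, 0 < A, 0 < B, 0 < alpha &
      forall n : nat, (1 <= n)%N ->
        phi n 1%N <= A * n%:R `^ alpha /\ phi n n <= B ^+ n * n`!%:R].
Proof.
split=> [[M [m [M0 m1 qM]]] | [phi [A [B [alpha]]]]].
  exists (markov_array M m), M, (M * expR m), m.
  split=> //.
  - by split; [exact: markov_array_KL | exact: qM].
  - by rewrite mulr_gt0 ?expR_gt0.
  - exact: lt_le_trans ltr01 m1.
  - move=> n n0; split; last exact: markov_array_diag.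
    by rewrite /markov_array (_ : 1`! = 1%N) // powR1 invr1 mulr1 mul1r expr1.
move=> [[phiKL q_phi] A0 B0 _ ends].
have [M M0 phiM] := KL_le_markov_array phiKL A0 B0 ends.
exists M, (Num.max 1 alpha); split=> // [|n k kn].
  by rewrite le_max lexx.
by apply: (le_trans (q_phi n k kn)); rewrite lee_fin phiM.
Qed.
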